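(* Let $n\geq 1$ and let $B\subseteq[n-1]$. The number of permutations $\sigma\in\tilde{\mathfrak S}_{n+1}$ with $D_3(\sigma)=B$ equals the number of permutations $\omega\in\mathfrak S_n$ with $\hat D(\omega)=B$.
   Context: $\mathfrak S_n$ is the set of permutations $\sigma=\sigma_1\cdots\sigma_n$ of $[n]=\{1,\dots,n\}$ (in one-line notation), and $\tilde{\mathfrak S}_{n}$ is the set of $\sigma\in\mathfrak S_n$ with $\sigma_1=1$. A permutation $\sigma\in\mathfrak S_m$ has a $3$-descent at position $i\in[m-2]$ if the triple $\sigma_i\sigma_{i+1}\sigma_{i+2}$, viewed (after standardization) as an element of $\mathfrak S_3$, is an odd permutation; $D_3(\sigma)$ is the set of such positions. A permutation $\omega\in\mathfrak S_n$ has an alternating descent at $i\in[n-1]$ if either $i$ is odd and $\omega_i>\omega_{i+1}$, or $i$ is even and $\omega_i<\omega_{i+1}$; $\hat D(\omega)$ is the set of such positions. *)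

(* Defs.v *)
From mathcomp Require Import all_boot all_fingroup.

Set Implicit Arguments.
Unset Strict Implicit.
Unset Printing Implicit Defensive.

(* A permutation of [n] = {1, ..., n} is an element of 'S_n, and both positions
   and values are shifted down by one: sigma_(i+1) = v+1 is written s i = v.
   In the same way the ordinal i : 'I_m stands for the position i+1 of [m], so
   that {set 'I_n.-1} is the type of subsets of [n-1]. *)

Section Standardization.

Variables (k m : nat) (f : 'I_k -> 'I_m).

Lemma std_subproof (i : 'I_k) : #|[set j | f j < f i]| < k.
Proof.
rewrite -[X in _ < X](card_ord k); apply: proper_card.
by apply/properP; split; [apply/subsetP | exists i; rewrite // inE ltnn].
Qed.

Definition std_fun (i : 'I_k) : 'I_k := Ordinal (std_subproof i).

Hypothesis f_inj : injective f.

Lemma std_fun_inj : injective std_fun.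
Proof.
have lt_std i j : f i < f j -> std_fun i < std_fun j.
  move=> lt_ij; apply: proper_card; apply/properP; split.
    by apply/subsetP=> l; rewrite !inE => /ltn_trans; apply.
  by exists i; rewrite !inE // ltnn.
move=> i j eq_ij; apply/f_inj/val_inj.
by case: (ltngtP (f i) (f j)) => // /lt_std; rewrite eq_ij ltnn.
Qed.

Definition std : 'S_k := perm std_fun_inj.

End Standardization.

Section ThreeDescents.

Variables (m : nat) (s : 'S_m).

Lemma window3_subproof (i : 'I_m.-2) (j : 'I_3) : i + j < m.
Proof.
case: m i => [|[|p]] [i lt_i] //=.
by rewrite -[p.+2]addn2 -addSn leq_add // -ltnS.
Qed.

Definition window3 (i : 'I_m.-2) (j : 'I_3) : 'I_m :=
  Ordinal (window3_subproof i j).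

Definition triple (i : 'I_m.-2) (j : 'I_3) : 'I_m := s (window3 i j).

Lemma triple_inj (i : 'I_m.-2) : injective (triple i).
Proof.
by move=> j l /perm_inj /(congr1 val) /= /addnI /val_inj.
Qed.

Definition D3 : {set 'I_m.-2} :=
  [set i | odd_perm (std (triple_inj (i := i)))].

End ThreeDescents.

Section AlternatingDescents.

Variables (n : nat) (w : 'S_n).

Definition this_pos (i : 'I_n.-1) : 'I_n := widen_ord (leq_pred n) i.

Lemma next_pos_subproof (i : 'I_n.-1) : i.+1 < n.
Proof. by case: n i => [|p] []. Qed.

Definition next_pos (i : 'I_n.-1) : 'I_n := Ordinal (next_pos_subproof i).

(* The parity is that of the 1-based position i.+1. *)
Definition altD : {set 'I_n.-1} :=
  [set i : 'I_n.-1 | (odd i.+1 && (w (next_pos i) < w (this_pos i)))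
                  || (~~ odd i.+1 && (w (this_pos i) < w (next_pos i)))].

End AlternatingDescents.

Definition Stilde_succ (n : nat) : {set 'S_n.+1} :=
  [set s : 'S_n.+1 | s ord0 == ord0].

(* Main.v *)
Require Import Defs.
From mathcomp Require Import all_boot all_fingroup.
From mathcomp Require Import zify.

(** Both families are encoded by sequences [K_0, ..., K_(n-1)] with [K_p <= p]
    in such a way that in either case a descent at [p] means
    [p < K_p + K_(p+1)].

    A triple is an even permutation iff its entries are in cyclic order, so for
    the 3-descents place the values on a circle: [K_p] counts the [q < p] such
    that [s q] lies on the open arc from [s p] to [s (p+1)].  If the triple at
    [p] is even, the arcs of [K_p] and [K_(p+1)] are disjoint; if it is odd,
    they cover every [s q] with [q <= p].  The sequence determines the cyclic
    arrangement (insert the points one at a time), hence [s] as [s 0 = 0].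

    For the alternating descents, [K_p] is the rank of [w p] among
    [w 0, ..., w (p-1)], counted from below for even [p] and from above for
    odd [p].

    Both encodings are injective into a set of [n`!] sequences, hence
    bijective. *)

Set Implicit Arguments.
Unset Strict Implicit.
Unset Printing Implicit Defensive.

(** * Cyclic order of natural numbers *)

(* Holds iff going upwards from a, cyclically, one meets b strictly before c. *)
Definition cyc (a b c : nat) := [|| a < b < c, b < c < a | c < a < b].

Lemma cyc_rot a b c : cyc a b c = cyc b c a.
Proof. by rewrite /cyc orbC -orbA. Qed.

Lemma cyc_nil a b :
  (cyc a a b = false) * (cyc a b a = false) * (cyc b a a = false).
Proof. by rewrite /cyc !ltnn; case: ltngtP. Qed.

Lemma cyc_swap a b c :
  a != b -> a != c -> b != c -> cyc a c b = ~~ cyc a b c.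
Proof. by rewrite /cyc; lia. Qed.

Lemma cyc_trans a b c d : cyc a b c -> cyc a c d -> cyc a b d.
Proof. by rewrite /cyc; lia. Qed.

Lemma cyc_disjoint a b c x : cyc a b c -> cyc a x b -> cyc b x c = false.
Proof. by rewrite /cyc; lia. Qed.

(** Cutting the circle at [m] makes it a line, and the three disjuncts are the orders abx, bxa, xab
    on that line; [~~ cyc m a x] says that [x] precedes [a]. *)
Lemma cyc_rebase m a b x :
    a != b -> a != m -> b != m -> a != x -> b != x -> m != x ->
  cyc a b x = [|| cyc m a b && cyc m b x, cyc m b x && ~~ cyc m a x
                | ~~ cyc m a x && cyc m a b].
Proof.
rewrite /cyc; case: (ltngtP a b) => //; case: (ltngtP a m) => //.
all: by case: (ltngtP b m) => //; lia.
Qed.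

(** * The codes and their bounds *)

Definition arc_code (f : nat -> nat) (p : nat) :=
  #|[set q : 'I_p | cyc (f p) (f q) (f p.+1)]|.

Definition rank_code (f : nat -> nat) (p : nat) :=
  #|[set q : 'I_p | f q < f p]|.

(* p is 0-based: odd p are the even positions of the paper. *)
Definition alt_rank_code (f : nat -> nat) (p : nat) :=
  if odd p then p - rank_code f p else rank_code f p.

(** Down-sets of a total relation are comparable by inclusion: a point of [A] outside [B] lies above
    all of [B], so [B] is contained in [A]. *)
Lemma set_downset_card_inj (T : finType) (R : rel T) (A B : {set T}) :
    (forall x y, x != y -> R x y || R y x) ->
    (forall x y, R x y -> y \in A -> x \in A) ->
    (forall x y, R x y -> y \in B -> x \in B) ->
  #|A| = #|B| -> A = B.
Proof.
move=> totR downA downB eqAB; apply/eqP; rewrite eqEcard eqAB leqnn andbT.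
case: (boolP (A \subset B)) => [//|/subsetPn[a Aa notBa]].
suff sBA : B \subset A.
  have /eqP eqBA : B == A by rewrite eqEcard sBA eqAB leqnn.
  by rewrite eqBA Aa in notBa.
apply/subsetP=> b Bb; have [->//|neq_ab] := eqVneq b a.
case/orP: (totR _ _ neq_ab) => [Rba|Rab]; first exact: downA Rba Aa.
by case/negP: notBa; apply: downB Rab Bb.
Qed.

Lemma rank_code_le f p : rank_code f p <= p.
Proof. by rewrite -[leqRHS](card_ord p) max_card. Qed.

Lemma arc_code_le f p : arc_code f p <= p.
Proof. by rewrite -[leqRHS](card_ord p) max_card. Qed.

Lemma alt_rank_code_le f p : alt_rank_code f p <= p.
Proof. by rewrite /alt_rank_code; have := rank_code_le f p; case: odd; lia. Qed.

Lemma card_ord_recr (p : nat) (P : nat -> bool) :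
  #|[set q : 'I_p.+1 | P q]| = #|[set q : 'I_p | P q]| + P p.
Proof.
rewrite -!sum1dep_card !(big_mkcond (fun i : 'I__ => P i)) big_ord_recr /=.
by case: (P p).
Qed.

(** * Descents read off from the codes *)

Section CodeDescents.

Variables (n : nat) (f : nat -> nat).
Hypothesis f_inj : forall a b, a < n -> b < n -> f a = f b -> a = b.

Lemma rank_code_descent p : p.+1 < n ->
  (f p.+1 < f p) = (rank_code f p.+1 <= rank_code f p).
Proof.
move=> ltpn; rewrite {1}/rank_code.
rewrite (card_ord_recr p (fun q => f q < f p.+1)) /rank_code.
have neq : f p != f p.+1 by apply/eqP=> /f_inj; lia.
apply/idP/idP => [lt_f | ].
  have -> : (f p < f p.+1) = false by lia.
  rewrite addn0; apply/subset_leq_card/subsetP=> q.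
  by rewrite !inE; lia.
apply: contraLR; rewrite -leqNgt -ltnNge => le_f.
have -> : f p < f p.+1 by lia.
rewrite /= addn1 ltnS; apply/subset_leq_card/subsetP=> q.
by rewrite !inE; lia.
Qed.

(** Exactly one of two consecutive ranks is reflected, which turns the comparison of ranks in
    [rank_code_descent] into a bound on a sum. *)
Lemma alt_rank_code_descent p : p.+1 < n ->
  (if odd p then f p < f p.+1 else f p.+1 < f p)
  = (p < alt_rank_code f p + alt_rank_code f p.+1).
Proof.
move=> ltpn; have := rank_code_descent ltpn; have neq : f p != f p.+1.
  by apply/eqP=> /f_inj; lia.
rewrite /alt_rank_code /=; have := rank_code_le f p.
have := rank_code_le f p.+1.
by case: (odd p) => /=; lia.
Qed.

Lemma arc_code_descent p : p.+2 < n ->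
  ~~ cyc (f p) (f p.+1) (f p.+2) = (p < arc_code f p + arc_code f p.+1).
Proof.
move=> ltpn.
rewrite {2}/arc_code (card_ord_recr p (fun q => cyc (f p.+1) (f q) (f p.+2))).
rewrite /arc_code.
set A := [set q : 'I_p | _]; set C := [set q : 'I_p | _].
have neq a b : a < n -> b < n -> a != b -> f a != f b.
  by move=> lta ltb; apply: contraNneq => /f_inj->.
have n01 : f p != f p.+1 by apply: neq; lia.
have n02 : f p != f p.+2 by apply: neq; lia.
have n12 : f p.+1 != f p.+2 by apply: neq; lia.
have UIAC := cardsUI A C.
(* The index [p] is itself counted in [arc_code f p.+1] exactly when the triple is odd; this extra
   unit makes the inequality strict. *)
have swap : cyc (f p.+1) (f p) (f p.+2) = ~~ cyc (f p) (f p.+1) (f p.+2).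
  by rewrite -cyc_swap // cyc_rot.
rewrite swap; case: (boolP (cyc (f p) _ _)) swap => [cyc_p _ | _ cyc_p] /=.
  have AC0 : A :&: C = set0.
    apply/setP=> q; rewrite !inE; apply/andP=> -[Aq].
    by rewrite (cyc_disjoint cyc_p Aq).
  have := max_card (A :|: C); rewrite card_ord; rewrite AC0 cards0 in UIAC.
  by rewrite addn0 -UIAC addn0 ltnNge => ->.
have ACT : A :|: C = setT.
  apply/setP=> q; rewrite !inE; have ltq := ltn_ord q.
  have nq0 : f p != f q by apply: neq; lia.
  have nq1 : f q != f p.+1 by apply: neq; lia.
  case: (boolP (cyc (f p) (f q) (f p.+1))) => //=; rewrite -cyc_swap //.
  by rewrite cyc_rot => cyc_q; apply: cyc_trans cyc_q cyc_p.
by rewrite addnA -UIAC ACT cardsT card_ord addn1 ltnS leq_addr.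
Qed.

End CodeDescents.

(** * Recovering the order from the codes *)

Section CodeInjectivity.

Variables (n : nat) (f g : nat -> nat).
Hypothesis f_inj : forall a b, a < n -> b < n -> f a = f b -> a = b.
Hypothesis g_inj : forall a b, a < n -> b < n -> g a = g b -> a = b.

Let neqf a b : a < n -> b < n -> a != b -> f a != f b.
Proof. by move=> lta ltb; apply: contraNneq => /f_inj->. Qed.

Let neqg a b : a < n -> b < n -> a != b -> g a != g b.
Proof. by move=> lta ltb; apply: contraNneq => /g_inj->. Qed.

Lemma rank_code_inj :
    (forall p, p < n -> rank_code f p = rank_code g p) ->
  forall a b, a < n -> b < n -> (f a < f b) = (g a < g b).
Proof.
move=> eq_fg.
suff IH m : m <= n -> forall a b, a < m -> b < m -> (f a < f b) = (g a < g b).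
  exact: IH.
elim: m => [|m IHm] ltmn a b //.
have {}IHm := IHm (ltnW ltmn).
(* By induction f and g order 'I_m in the same way, and both sets below are
   down-sets for this order. *)
have new q : q < m -> (f q < f m) = (g q < g m).
  move=> ltqm; have /setP/(_ (Ordinal ltqm)) : [set q : 'I_m | f q < f m] =
    [set q : 'I_m | g q < g m].
    apply: (@set_downset_card_inj _ (fun x y : 'I_m => f x < f y)).
    - move=> x y; rewrite -neq_ltn.
      by apply: neqf; apply: ltn_trans ltmn; apply: ltn_ord.
    - by move=> x y; rewrite !inE; apply: ltn_trans.
    - by move=> x y; rewrite !inE IHm //; apply: ltn_trans.
    - exact: eq_fg.
  by rewrite !inE.
have neqm q : q < m -> f q != f m /\ g q != g m.
  by move=> ltqm; split; [apply: neqf | apply: neqg]; lia.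
rewrite !ltnS [a <= m]leq_eqVlt [b <= m]leq_eqVlt.
move=> /orP[/eqP->|lta] /orP[/eqP->|ltb].
- by rewrite !ltnn.
- by have := new b ltb; have := neqm b ltb; lia.
- exact: new.
- exact: IHm.
Qed.

Lemma alt_rank_code_inj :
    (forall p, p < n -> alt_rank_code f p = alt_rank_code g p) ->
  forall a b, a < n -> b < n -> (f a < f b) = (g a < g b).
Proof.
move=> eq_fg; apply: rank_code_inj => p /eq_fg.
rewrite /alt_rank_code; have := rank_code_le f p; have := rank_code_le g p.
by case: (odd p); lia.
Qed.

Lemma arc_code_cyc :
    (forall p, p.+1 < n -> arc_code f p = arc_code g p) ->
  forall a b c, a < n -> b < n -> c < n ->
  cyc (f a) (f b) (f c) = cyc (g a) (g b) (g c).
Proof.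
move=> eq_fg.
suff IH m : m <= n -> forall a b c, a < m -> b < m -> c < m ->
    cyc (f a) (f b) (f c) = cyc (g a) (g b) (g c).
  exact: IH.
elim: m => [|[_|m IHm]] ltmn a b c //.
  by rewrite !ltnS !leqn0 => /eqP-> /eqP-> /eqP->; rewrite /cyc; lia.
have {}IHm := IHm (ltnW ltmn).
have ltm x : x <= m -> x < n by lia.
have neqm q : q <= m -> (f q != f m.+1) * (g q != g m.+1).
  by move=> ltqm; split; [apply: neqf | apply: neqg]; lia.
have neq x y : x <= m -> y <= m -> x != y -> (f x != f y) * (g x != g y).
  by move=> /ltm ltx /ltm lty ne; split; [apply: neqf | apply: neqg].
(* Same down-set argument, for 'I_m ordered cyclically starting from m. *)
have arc q : q <= m ->
    cyc (f m) (f q) (f m.+1) = cyc (g m) (g q) (g m.+1).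
  rewrite leq_eqVlt => /orP[/eqP->|ltqm]; first by rewrite !cyc_nil.
  have /setP/(_ (Ordinal ltqm)) :
      [set q : 'I_m | cyc (f m) (f q) (f m.+1)] =
      [set q : 'I_m | cyc (g m) (g q) (g m.+1)].
    apply: (@set_downset_card_inj _ (fun x y : 'I_m => cyc (f m) (f x) (f y))).
    - move=> x y neq_xy; have ltx := ltn_ord x; have lty := ltn_ord y.
      have neq_m z : z < m -> f m != f z.
        by move=> ltz; rewrite neq ?(ltnW ltz) // gtn_eqF.
      have neq_f : f x != f y by rewrite neq ?(ltnW ltx) ?(ltnW lty).
      by rewrite (@cyc_swap _ (f x) (f y)) ?neq_m ?orbN.
    - by move=> x y; rewrite !inE; apply: cyc_trans.
    - move=> x y; have ltx := ltn_ord x; have lty := ltn_ord y.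
      by rewrite !inE IHm ?ltnS ?(ltnW ltx) ?(ltnW lty) //; apply: cyc_trans.
    - exact: eq_fg.
  by rewrite !inE.
(* A triple ending at the new index [m.+1] reduces to arcs starting at [m]: directly, by a rotation
   and a swap, or by [cyc_rebase]. *)
have new x y : x <= m -> y <= m ->
    cyc (f x) (f y) (f m.+1) = cyc (g x) (g y) (g m.+1).
  move=> lex ley.
  have [<-|neq_xy] := eqVneq x y; first by rewrite !cyc_nil.
  have [->|neq_xm] := eqVneq x m; first exact: arc.
  have [->|neq_ym] := eqVneq y m.
    rewrite [LHS]cyc_rot [RHS]cyc_rot (@cyc_swap _ (f x)).
    - rewrite (@cyc_swap _ (g x)) ?arc ?neqm //.
      by rewrite neq // eq_sym.
    - by rewrite neq // eq_sym.
    - by rewrite neqm.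
    - by rewrite neqm.
  rewrite (@cyc_rebase (f m)) ?neqm ?neq //.
  rewrite (@cyc_rebase (g m) (g x)) ?neqm ?neq //.
  by rewrite !arc // IHm.
(* If two of [a], [b], [c] are the new index, both sides are false; a single one is rotated to the
   end. *)
rewrite !ltnS [a <= _]leq_eqVlt [b <= _]leq_eqVlt [c <= _]leq_eqVlt.
move=> /orP[/eqP->|lta] /orP[/eqP->|ltb] /orP[/eqP->|ltc]; rewrite ?cyc_nil //.
- by rewrite [LHS]cyc_rot [RHS]cyc_rot new.
- by rewrite -[LHS]cyc_rot -[RHS]cyc_rot new.
- by rewrite new.
- exact: IHm.
Qed.

(** The value 0 at index 0 cuts the circle open: for positive [x], [cyc 0 x y] is [x < y]. *)
Lemma arc_code_inj :
    f 0 = 0 -> g 0 = 0 ->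
    (forall p, p.+1 < n -> arc_code f p = arc_code g p) ->
  forall a b, a < n -> b < n -> (f a < f b) = (g a < g b).
Proof.
move=> f0 g0 eq_fg a b lta ltb.
have [->|a_neq0] := posnP a.
  have := @neqf 0 b; have := @neqg 0 b; have [->|] := posnP b; lia.
have := arc_code_cyc eq_fg (leq_ltn_trans (leq0n _) lta) lta ltb.
have := @neqf 0 a; have := @neqg 0 a; rewrite f0 g0 /cyc.
have [->|] := posnP b; lia.
Qed.

End CodeInjectivity.

(** * 3-descents in terms of cyclic order *)

Lemma cyc_perm3 (s : 'S_3) :
  odd_perm s = ~~ cyc (s (@Ordinal 3 0 isT)) (s (@Ordinal 3 1 isT))
                      (s (@Ordinal 3 2 isT)).
Proof.
set i0 := Ordinal _; set i1 := Ordinal _; set i2 := Ordinal _.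
have ord3 (i : 'I_3) : [\/ i = i0, i = i1 | i = i2].
  case: i => [[|[|[|//]]] lti];
    [constructor 1 | constructor 2 | constructor 3]; exact: val_inj.
have tpermK (v : 'S_3) x y : (v * tperm x y * tperm x y = v)%g.
  by rewrite -mulgA tperm2 mulg1.
(* Two transpositions bring s back to the identity. *)
pose t := (s * tperm (s i0) i0)%g; pose u := (t * tperm (t i1) i1)%g.
have t0 : t i0 = i0 by rewrite permM tpermL.
have u0 : u i0 = i0.
  by rewrite permM t0 tpermD // -[X in _ != X]t0 (inj_eq perm_inj).
have u1 : u i1 = i1 by rewrite permM tpermL.
have u_id : u = 1%g.
  apply/permP=> i; rewrite perm1; case: (ord3 i) => -> //.
  by case: (ord3 (u i2)) => // u2;
    [have := u0 | have := u1]; rewrite -u2 => /perm_inj.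
have t1 : t i1 = if s i1 == i0 then s i0 else s i1.
  by rewrite permM; case: tpermP => [/perm_inj//|->|_ /eqP/negPf->];
    rewrite ?eqxx.
have -> : odd_perm s = (t i1 != i1) (+) (s i0 != i0).
  rewrite -!odd_tperm -odd_permM.
  have sE : s = (u * tperm (t i1) i1 * tperm (s i0) i0)%g.
    by rewrite !tpermK.
  by rewrite [in LHS]sE u_id mul1g.
rewrite t1.
(* Of the 27 value triples, distinctness leaves six, settled by computation. *)
have : [&& s i0 != s i1, s i0 != s i2 & s i1 != s i2].
  by rewrite !(inj_eq perm_inj).
by case: (ord3 (s i0)) => ->; case: (ord3 (s i1)) => ->;
  case: (ord3 (s i2)) => ->.
Qed.

Lemma ltn_std (k m : nat) (f : 'I_k -> 'I_m) (f_inj : injective f)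
    (i j : 'I_k) :
  (std f_inj i < std f_inj j) = (f i < f j).
Proof.
have lt_std a b : f a < f b -> std f_inj a < std f_inj b.
  move=> lt_ab; rewrite !permE; apply: proper_card; apply/properP; split.
    by apply/subsetP=> l; rewrite !inE => /ltn_trans; apply.
  by exists a; rewrite !inE // ltnn.
apply/idP/idP => [|/lt_std//]; apply: contraTT; rewrite -!leqNgt leq_eqVlt.
by case/orP=> [/eqP/val_inj/f_inj->//|/lt_std/ltnW].
Qed.

(** [cyc] depends only on the relative order of its arguments, so standardization drops out. *)
Lemma mem_D3 (m : nat) (s : 'S_m) (i : 'I_m.-2) (i0 i1 i2 : 'I_m) :
    i0 = i :> nat -> i1 = i.+1 :> nat -> i2 = i.+2 :> nat ->
  (i \in D3 s) = ~~ cyc (s i0) (s i1) (s i2).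
Proof.
move=> e0 e1 e2; rewrite inE cyc_perm3 /cyc !ltn_std /triple.
have win (j : 'I_3) (l : 'I_m) : l = i + j :> nat -> window3 i j = l.
  by move=> e; apply: val_inj; rewrite /= e.
rewrite (win (@Ordinal 3 0 isT) i0) /= ?addn0 //.
rewrite (win (@Ordinal 3 1 isT) i1) /= ?addn1 //.
by rewrite (win (@Ordinal 3 2 isT) i2) /= ?addn2.
Qed.

Lemma card_ltn_ord (m n : nat) : m <= n -> #|[set k : 'I_n | k < m]| = m.
Proof.
move=> le_mn; rewrite -sum1dep_card (big_ord_narrow le_mn) sum1_card.
exact: card_ord.
Qed.

(** * Permutations as sequences of natural numbers *)

(** The value [s i] is the number of [j] with [s j < s i]. *)
Lemma perm_ltn_inj (n : nat) (s t : 'S_n) :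
  (forall i j, (s i < s j) = (t i < t j)) -> s = t.
Proof.
move=> lt_st.
have card_lt (u : 'S_n) i :
    #|[set j | u j < u i]| = #|[set k : 'I_n | k < u i]|.
  rewrite -[RHS](card_preimset _ (@perm_inj _ u)); apply: eq_card => j.
  by rewrite !inE.
apply/permP=> i; apply: val_inj => /=.
rewrite -[LHS](card_ltn_ord (ltnW (ltn_ord _))).
rewrite -[RHS](card_ltn_ord (ltnW (ltn_ord _))) -!card_lt; apply: eq_card => j.
by rewrite !inE lt_st.
Qed.

(** [inord] allows any index without a bound proof; for [p > n] it returns the default [ord0], so
    injectivity holds only below [n.+1]. *)
Definition seq_of_perm (n : nat) (s : 'S_n.+1) (p : nat) : nat := s (inord p).

Lemma seq_of_perm_val n (s : 'S_n.+1) (i : 'I_n.+1) : seq_of_perm s i = s i.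
Proof. by rewrite /seq_of_perm inord_val. Qed.

Lemma seq_of_perm_inj n (s : 'S_n.+1) a b :
  a < n.+1 -> b < n.+1 -> seq_of_perm s a = seq_of_perm s b -> a = b.
Proof.
by move=> lta ltb /val_inj/perm_inj/(congr1 val); rewrite /= !inordK.
Qed.

Lemma eq_perm_seq n (s t : 'S_n.+1) :
  (forall a b, a < n.+1 -> b < n.+1 ->
     (seq_of_perm s a < seq_of_perm s b) =
     (seq_of_perm t a < seq_of_perm t b)) ->
  s = t.
Proof.
by move=> eq_st; apply: perm_ltn_inj => i j; rewrite -!seq_of_perm_val eq_st.
Qed.

(** * Counting codes and transferring fibers *)

Definition codes (n : nat) : {set {ffun 'I_n -> 'I_n}} :=
  [set c in family (fun p : 'I_n => [pred x : 'I_n | x <= p])].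

Lemma card_codes n : #|codes n| = n`!.
Proof.
rewrite cardsE card_family foldrE big_image /= fact_prod big_add1 big_mkord.
apply: eq_bigr => p _; rewrite -(card_ltn_ord (ltn_ord p)).
by apply: eq_card => x; rewrite !inE ltnS.
Qed.

Definition code_of (n : nat) (h : nat -> nat) : {ffun 'I_n.+1 -> 'I_n.+1} :=
  [ffun p : 'I_n.+1 => inord (h p)].

Lemma code_of_codes n h : (forall p, h p <= p) -> code_of n h \in codes n.+1.
Proof.
move=> le_h; rewrite inE; apply/familyP=> p; rewrite ffunE inE.
by rewrite inordK // (leq_ltn_trans (le_h p)).
Qed.

Lemma code_of_val n h (p : 'I_n.+1) :
  (forall p, h p <= p) -> code_of n h p = h p :> nat.
Proof. by move=> le_h; rewrite ffunE inordK // (leq_ltn_trans (le_h p)). Qed.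

Lemma code_of_eq n h k : (forall p, h p <= p) -> (forall p, k p <= p) ->
  code_of n h = code_of n k -> forall p, p < n.+1 -> h p = k p.
Proof.
move=> le_h le_k eq_hk p ltp.
by have := code_of_val (Ordinal ltp) le_h; rewrite eq_hk code_of_val.
Qed.

Definition code_descents (n : nat) (c : {ffun 'I_n -> 'I_n}) : {set 'I_n.-1} :=
  [set i : 'I_n.-1 | i < c (this_pos i) + c (next_pos i)].

(** As [F] is no larger than [A], the injection [phi] is onto [F]; it carries [d] to [e], hence
    fibers bijectively to fibers. *)
Lemma card_fiber_transfer (T C U : finType) (A : {set T}) (F : {set C})
    (phi : T -> C) (d : T -> U) (e : C -> U) (B : U) :
    {in A &, injective phi} -> {in A, forall x, phi x \in F} -> #|F| <= #|A| ->
    {in A, forall x, d x = e (phi x)} ->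
  #|[set x in A | d x == B]| = #|[set c in F | e c == B]|.
Proof.
move=> phi_inj phiF leFA dE.
have imA : phi @: A = F.
  apply/eqP; rewrite eqEcard card_in_imset // leFA andbT.
  by apply/subsetP=> _ /imsetP[x Ax ->]; apply: phiF.
rewrite -imA -(card_in_imset (f := phi)); last first.
  by move=> x y; rewrite !inE => /andP[Ax _] /andP[Ay _]; apply: phi_inj.
apply: eq_card => c; rewrite inE; apply/imsetP/andP.
  by case=> x; rewrite inE => /andP[Ax dx] ->; rewrite imset_f // -dE.
by case=> /imsetP[x Ax ->] ex; exists x => //; rewrite inE Ax dE.
Qed.

(** Prepending a fixed first point by [lift_perm] embeds ['S_n] in [Stilde_succ n]. *)
Lemma card_Stilde n : n`! <= #|Stilde_succ n|.
Proof.
have lift_inj : injective (@lift_perm n ord0 ord0).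
  move=> s t eq_st; apply/permP=> i; apply: (@lift_inj _ ord0).
  by rewrite -!(lift_perm_lift ord0) eq_st.
rewrite -card_Sn -cardsT -(card_imset _ lift_inj); apply/subset_leq_card.
by apply/subsetP=> _ /imsetP[s _ ->]; rewrite inE lift_perm_id.
Qed.

Theorem theorem2p3 (n : nat) (hn : 1 <= n) (B : {set 'I_n.-1}) :
  #|[set s : 'S_n.+1 | (s \in Stilde_succ n) && (D3 s == B)]|
  = #|[set w : 'S_n | altD w == B]|.
Proof.
case: n hn B => [//|n] _ B.
(* An arc code looks one index ahead, so [n.+2] points yield [n.+1] entries, as many as the rank
   code of [n.+1] points has. *)
pose arcs (s : 'S_n.+2) := code_of n (arc_code (seq_of_perm s)).
pose ranks (w : 'S_n.+1) := code_of n (alt_rank_code (seq_of_perm w)).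
have arc_le (s : 'S_n.+2) := arc_code_le (seq_of_perm s).
have rank_le (w : 'S_n.+1) := alt_rank_code_le (seq_of_perm w).
rewrite (card_fiber_transfer (F := codes n.+1) (phi := arcs)
           (e := @code_descents n.+1)).
- have -> : [set w : 'S_n.+1 | altD w == B] =
            [set w in [set: 'S_n.+1] | altD w == B].
    by apply/setP=> w; rewrite !inE.
  symmetry.
  apply: (card_fiber_transfer (F := codes n.+1) (phi := ranks)
            (e := @code_descents n.+1)).
  + move=> w w' _ _ /(code_of_eq (rank_le w) (rank_le w')) eq_ww'.
    apply: eq_perm_seq.
    exact: (alt_rank_code_inj (@seq_of_perm_inj _ w) (@seq_of_perm_inj _ w')).
  + by move=> w _; apply: code_of_codes.
  + by rewrite card_codes cardsT card_Sn.
  + move=> w _; apply/setP=> i; rewrite !inE !code_of_val //=.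
    rewrite -(alt_rank_code_descent (@seq_of_perm_inj _ w)) ?ltnS //.
    rewrite -!seq_of_perm_val /=.
    (* [altD] tests the parity of [i.+1], the rank code that of [i]. *)
    by case: (odd i); rewrite ?orbF.
- move=> s s'; rewrite !inE => /eqP s0 /eqP s'0.
  move=> /(code_of_eq (arc_le s) (arc_le s')) eq_ss'.
  have val0 (t : 'S_n.+2) : t ord0 = ord0 -> seq_of_perm t 0 = 0.
    by move=> t0; have /= := seq_of_perm_val t ord0; rewrite t0.
  apply: eq_perm_seq.
  exact: (arc_code_inj (@seq_of_perm_inj _ s) (@seq_of_perm_inj _ s')
            (val0 _ s0) (val0 _ s'0)).
- by move=> s _; apply: code_of_codes.
- by rewrite card_codes card_Stilde.
move=> s _; apply/setP=> i; have lti := ltn_ord i.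
have lt0 : i < n.+2 by lia.
have lt1 : i.+1 < n.+2 by lia.
have lt2 : i.+2 < n.+2 by lia.
rewrite (@mem_D3 _ _ _ (Ordinal lt0) (Ordinal lt1) (Ordinal lt2)) //.
rewrite inE !code_of_val //= -!seq_of_perm_val /=.
by rewrite -(arc_code_descent (@seq_of_perm_inj _ s)).
Qed.
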